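(* Let $a,d,c$ be positive integers and $k\ge2$ an integer with $\gcd(a,a+d,\ldots,a+kd,c)=1$, and let $\mathcal{S}=\langle a,a+d,\ldots,a+kd,c\rangle$. Then $\mathcal{S}$ is pseudo-symmetric if and only if $\gcd(a,d)=1$ and one of the following holds: (a) $\mathcal{S}=\langle3,3+d,3+2d\rangle$ (as sets); (b) $a(c-1)=2(c+d)$ with $c$ odd; (c.1) $a\equiv1$ or $5\pmod 6$, $c(a-3)=6d$, and $a\le 2kd+3$; (c.2) there exist integers $\lambda\ge1$, $\mu\ge1$, $n\ge1$ such that $a=(2+\lambda k)(n+1)+1$, $c+(2+\lambda k)d=\mu a$, and $a+kd=\dfrac{cn-3d}{\lambda}$; (d) there exist integers $\lambda\ge2$, $\mu\ge1$, $v\ge0$ such that $a=(v+1)(2+(\lambda-2)k)+(\lambda k+1)$, $c+(2+(\lambda-2)k)d=\mu a$, and $a+kd=\dfrac{c(v+1)-d}{\lambda}$; (e) there exist integers $q_1\ge2$, $R_0\equiv2\pmod k$ and $s_0\equiv2\pmod k$ such that $a=(q_1-1)s_0+1$, $a+kd=q_1R_0+2k-1$, and $kc=(R_0+2k-1)(s_0-1)+2k-1$; (f) there exist integers $q_1\ge2$, $R_0\equiv2\pmod k$ and $s_0\equiv2\pmod k$ with $s_0\ne2$ such that $a=(q_1-1)s_0+3$, $a+kd=q_1R_0+1$, and $kc=(R_0+1)(s_0-3)+3$.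
   Context: $\langle b_1,\ldots,b_t\rangle$ denotes the numerical semigroup of non-negative integer combinations of $b_1,\ldots,b_t$. For a numerical semigroup $\mathcal{S}$ with Frobenius number $g$ (largest integer not in $\mathcal{S}$), $\mathcal{S}$ is pseudo-symmetric if $g$ is even and $\mathcal{S}\cup(g-\mathcal{S})=\mathbb{Z}\setminus\{g/2\}$, where $g-\mathcal{S}=\{g-s:s\in\mathcal{S}\}$. *)

(* Defs.v *)
From Stdlib Require Import ZArith List.
Open Scope Z_scope.

Fixpoint in_sg (gs : list Z) (z : Z) : Prop :=
  match gs with
  | nil => z = 0
  | g :: gs' => exists m : Z, 0 <= m /\ in_sg gs' (z - m * g)
  end.

Definition gcd_list (gs : list Z) : Z := fold_right Z.gcd 0 gs.

Definition is_frobenius (S : Z -> Prop) (g : Z) : Prop :=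
  ~ S g /\ (forall z, g < z -> S z).

Definition pseudo_symmetric (S : Z -> Prop) : Prop :=
  exists g, is_frobenius S g /\ Z.Even g /\
    (forall z, (S z \/ (exists s, S s /\ z = g - s)) <-> z <> g / 2).

Definition ap_gens (a d : Z) (k : nat) (c : Z) : list Z :=
  map (fun i => a + Z.of_nat i * d) (seq 0 (S k)) ++ (c :: nil).

(* Main.v *)
Require Import Defs.
From Stdlib Require Import ZArith List Lia Znumtheory.
Open Scope Z_scope.

(** Write [S] for the semigroup.  Comparing the gaps of [S] in the cosets of [gcd a d] shows that
pseudo-symmetry forces [gcd a d = 1].  Then every residue class modulo [a] contains numbers
[d y + c w] with [y, w >= 0], and the least element of [S] using [(y, w)] is
[cost y w = a ceil(y / k) + d y + c w].  Rödseth's variant of the Euclidean algorithm gives a basis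
[(s, -P), (s', -P')] of the lattice [{(y, w) : a | d y + c w}] for which the costs of the points of
the L-shape [[0, s - s') x [0, P')  U  [0, s) x [0, P' - P)] form the Apéry set of [a].  The
largest cost is attained at one of the two outer corners of the L-shape, and [S] is pseudo-symmetric iff
[cost q + cost q* = cost corner] for every [q] except one, at which the sum is larger by [a]; here
[q*] is the point of the L-shape congruent to [corner - q].  The defect of this identity is
[ceil(y / k) + ceil((N - y) / k) - ceil(Y / k)], with [N = Y] on the rectangle below the corner
[(Y, W)] and [N] shifted by [R] or [R'] on the remaining rectangle; requiring it to vanish for all
but one point leaves six shapes, which are the cases of the theorem. *)

(** * Semigroups generated by a list *)

Lemma in_sg_0 (gs : list Z) : in_sg gs 0.
Proof.
  induction gs as [|g gs IH]; simpl; [reflexivity|].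
  exists 0; split; [lia|]. now replace (0 - 0 * g) with 0 by ring.
Qed.

Lemma in_sg_add (gs : list Z) (x y : Z) : in_sg gs x -> in_sg gs y -> in_sg gs (x + y).
Proof.
  revert x y; induction gs as [|g gs IH]; simpl; intros x y.
  - lia.
  - intros (m & Hm & Hx) (n & Hn & Hy). exists (m + n); split; [lia|].
    replace (x + y - (m + n) * g) with ((x - m * g) + (y - n * g)) by ring. auto.
Qed.

Lemma in_sg_gen (gs : list Z) (g : Z) : In g gs -> in_sg gs g.
Proof.
  induction gs as [|h gs IH]; simpl; [easy|]. intros [->|H].
  - exists 1; split; [lia|]. replace (g - 1 * g) with 0 by ring. apply in_sg_0.
  - exists 0; split; [lia|]. replace (g - 0 * h) with g by ring. auto.
Qed.

Lemma in_sg_ind (gs : list Z) (Q : Z -> Prop) :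
  Q 0 -> (forall x y, Q x -> Q y -> Q (x + y)) -> (forall g, In g gs -> Q g) ->
  forall z, in_sg gs z -> Q z.
Proof.
  intros H0 Hadd. induction gs as [|g gs IH]; simpl; intros Hg z.
  - now intros ->.
  - intros (m & Hm & Hz).
    assert (HQ : Q (z - m * g)) by (apply IH; auto).
    assert (Hmg : Q (m * g)).
    { clear Hz HQ. revert m Hm. apply natlike_ind.
      - exact H0.
      - intros m _ Hm. replace (Z.succ m * g) with (m * g + g) by ring. auto. }
    replace z with ((z - m * g) + m * g) by ring. auto.
Qed.

Lemma in_sg_mul (gs : list Z) (n x : Z) : 0 <= n -> in_sg gs x -> in_sg gs (n * x).
Proof.
  intros Hn Hx. revert n Hn. apply natlike_ind.
  - apply in_sg_0.
  - intros m _ Hm. replace (Z.succ m * x) with (m * x + x) by ring. now apply in_sg_add.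
Qed.

Lemma gcd_list_divide (gs : list Z) (x : Z) :
  (forall g, In g gs -> (x | g)) -> (x | gcd_list gs).
Proof.
  induction gs as [|g gs IH]; simpl; intros H.
  - apply Z.divide_0_r.
  - apply Z.gcd_greatest; auto.
Qed.

Lemma in_ap_gens (a d : Z) (k : nat) (c g : Z) :
  In g (ap_gens a d k c) <->
  (exists i, 0 <= i <= Z.of_nat k /\ g = a + i * d) \/ g = c.
Proof.
  unfold ap_gens. rewrite in_app_iff, in_map_iff. split.
  - intros [(i & <- & Hi)|[->|[]]]; [left|now right].
    apply in_seq in Hi. exists (Z.of_nat i). lia.
  - intros [(i & Hi & ->)| ->]; [left|right; now left].
    exists (Z.to_nat i). rewrite Z2Nat.id by lia. split; [reflexivity|].
    apply in_seq. lia.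
Qed.

(** * Arithmetic progressions with one extra generator *)

(** A sum of [n] progression terms is [a * n + d * y], where [y] takes every value from 0 to
    [k * n]; [w] counts the copies of [c]. *)
Definition ap_sg (a d c k z : Z) : Prop :=
  exists n y w, 0 <= n /\ 0 <= y <= k * n /\ 0 <= w /\ z = a * n + d * y + c * w.

Lemma in_ap_sg (a d c : Z) (k : nat) (z : Z) :
  in_sg (ap_gens a d k c) z <-> ap_sg a d c (Z.of_nat k) z.
Proof.
  split.
  - revert z. apply in_sg_ind.
    + exists 0, 0, 0; lia.
    + intros x x' (n & y & w & ?) (n' & y' & w' & ?).
      exists (n + n'), (y + y'), (w + w'); lia.
    + intros g Hg. apply in_ap_gens in Hg as [(i & Hi & ->)| ->].
      * exists 1, i, 0; lia.
      * exists 0, 0, 1; lia.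
  - intros (n & y & w & Hn & Hy & Hw & ->).
    apply in_sg_add.
    + clear w Hw. revert y Hy. pattern n. revert n Hn. apply natlike_ind.
      * intros y Hy. assert (y = 0) as -> by lia.
        replace (a * 0 + d * 0) with 0 by ring. apply in_sg_0.
      * intros n Hn IH y Hy. set (i := Z.min y (Z.of_nat k)).
        replace (a * Z.succ n + d * y) with ((a + i * d) + (a * n + d * (y - i))) by lia.
        apply in_sg_add; [apply in_sg_gen, in_ap_gens; left; exists i; lia|].
        apply IH. lia.
    + rewrite Z.mul_comm. apply in_sg_mul, in_sg_gen, in_ap_gens; auto.
Qed.

Lemma pseudo_symmetric_ext (S T : Z -> Prop) :
  (forall z, S z <-> T z) -> pseudo_symmetric S -> pseudo_symmetric T.
Proof.
  intros E (g & (Hg & Hgt) & Hev & H). exists g. split; [split|split].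
  - now rewrite <- E.
  - intros z Hz. apply E. auto.
  - exact Hev.
  - intros z. rewrite <- H, <- E.
    split; (intros [?|(x & ? & ?)]; [auto|right; exists x; split; [now apply E|auto]]).
Qed.

Lemma ap_sg_add (a d c k x y : Z) : ap_sg a d c k x -> ap_sg a d c k y -> ap_sg a d c k (x + y).
Proof.
  intros (n & y1 & w & ?) (n' & y1' & w' & ?). exists (n + n'), (y1 + y1'), (w + w'). lia.
Qed.

(* Write z = c j + e t with e = gcd (a, d) and 0 <= j < e; membership in the
   semigroup depends on t only, so a failure of symmetry at one j occurs at
   every j. *)
Lemma ap_sg_pseudo_symmetric_coprime (a d c k : Z) :
  0 < a -> 0 < c -> Z.gcd (Z.gcd a d) c = 1 ->
  pseudo_symmetric (ap_sg a d c k) -> Z.gcd a d = 1.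
Proof.
  intros Ha Hc Hg (F & (HF & HFgt) & _ & HPS).
  pose proof (Z.gcd_nonneg a d) as He0.
  pose proof (Z.gcd_divide_l a d) as [a' Ha'].
  pose proof (Z.gcd_divide_r a d) as [d' Hd'].
  set (e := Z.gcd a d) in *. clearbody e.
  assert (He : 0 < e).
  { destruct (Z.eq_dec e 0) as [E|]; [rewrite E in Ha'|]; lia. }
  destruct (Z.eq_dec e 1) as [|He1]; [assumption|exfalso].
  (* As [e] divides [a] and [d] and is coprime to [c], the number [w] of copies of [c] is
     [j + e * i] with [i >= 0]; replacing it by [j' + e * i] changes only the first coordinate. *)
  assert (Hindep : forall j t j', 0 <= j < e -> 0 <= j' ->
            ap_sg a d c k (c * j + e * t) -> ap_sg a d c k (c * j' + e * t)).
  { intros j t j' Hj Hj' (n & y & w & Hn & Hy & Hw & E).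
    assert (D : (e | w - j)).
    { apply Z.gauss with c; [|exact Hg]. exists (t - a' * n - d' * y).
      rewrite Ha', Hd' in E. nia. }
    destruct D as [i Hi]. assert (Hi0 : 0 <= i) by nia.
    exists n, y, (j' + e * i). replace w with (j + i * e) in E by lia.
    repeat split; nia. }
  assert (Hrep : forall z, exists j t, 0 <= j < e /\ z = c * j + e * t).
  { intros z. destruct (Z.gcd_bezout c e 1) as (u & v & Huv).
    { now rewrite Z.gcd_comm. }
    exists ((z * u) mod e), (z * v + c * ((z * u) / e)). split; [apply Z.mod_pos_bound; lia|].
    pose proof (Z.div_mod (z * u) e ltac:(lia)) as E.
    transitivity (z * (u * c + v * e)); [rewrite Huv; ring|].
    replace (z * (u * c + v * e)) with (c * (z * u) + e * (z * v)) by ring.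
    rewrite E at 1. ring. }
  destruct (Hrep F) as (j0 & t0 & Hj0 & EF).
  (* Otherwise [F + c], which exceeds [F] and so lies in the semigroup, has the same second
     coordinate as [F]. *)
  assert (Ej0 : j0 = e - 1).
  { destruct (Z.eq_dec j0 (e - 1)); [assumption|exfalso]. apply HF. rewrite EF.
    apply (Hindep (j0 + 1)); [lia|lia|]. apply HFgt. rewrite EF. nia. }
  destruct (Hrep (F / 2)) as (j & t & Hj & Eh).
  assert (Hh : ~ ap_sg a d c k (F / 2)).
  { intros H. specialize (HPS (F / 2)). tauto. }
  assert (Hh' : ~ ap_sg a d c k (F - F / 2)).
  { intros H. specialize (HPS (F / 2)). apply HPS; [|reflexivity]. right. exists (F - F / 2).
    split; [assumption|ring]. }
  (* A number with the second coordinate of [F / 2] but another first one must satisfy symmetry;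
     moving it back puts [F / 2] or [F - F / 2] into the semigroup. *)
  assert (exists j', 0 <= j' < e /\ j' <> j) as (j' & Hj' & Hne).
  { destruct (Z.eq_dec j 0); [exists 1|exists 0]; lia. }
  destruct (proj2 (HPS (c * j' + e * t))) as [H|(x & Hx & Ex)].
  - rewrite Eh. intros E. apply Hne. nia.
  - apply Hh. rewrite Eh. apply (Hindep j'); [lia|lia|assumption].
  - apply Hh'. rewrite Eh, EF.
    replace (c * j0 + e * t0 - (c * j + e * t)) with (c * (e - 1 - j) + e * (t0 - t))
      by (rewrite Ej0; ring).
    apply (Hindep (e - 1 - j')); [lia|lia|].
    replace (c * (e - 1 - j') + e * (t0 - t)) with x; [assumption|].
    rewrite EF, Ej0 in Ex. lia.
Qed.

(** * Ceiling division *)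

Lemma divide_small (k x : Z) : (k | x) -> - k < x < k -> x = 0.
Proof.
  intros D Hx. destruct (Z.eq_dec x 0); [assumption|].
  pose proof (Zdivide_bounds k x D). lia.
Qed.

(** The ceiling of [y / k], also for negative [y], because [Z.div] rounds down. *)
Definition up (k y : Z) : Z := (y + k - 1) / k.

Lemma up_spec (k y : Z) : 0 < k -> k * (up k y - 1) < y <= k * up k y.
Proof.
  intros Hk. unfold up. pose proof (Z.div_mod (y + k - 1) k ltac:(lia)).
  pose proof (Z.mod_pos_bound (y + k - 1) k Hk). lia.
Qed.

Lemma up_unique (k y q : Z) : 0 < k -> k * (q - 1) < y <= k * q -> up k y = q.
Proof. intros Hk Hq. pose proof (up_spec k y Hk). nia. Qed.

Lemma up_add_mul (k y t : Z) : 0 < k -> up k (y + k * t) = up k y + t.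
Proof. intros Hk. apply up_unique; [assumption|]. pose proof (up_spec k y Hk). lia. Qed.

Lemma up_le (k x y : Z) : 0 < k -> x <= y -> up k x <= up k y.
Proof.
  intros Hk Hxy. pose proof (up_spec k x Hk). pose proof (up_spec k y Hk). nia.
Qed.

Lemma up_0 (k : Z) : 0 < k -> up k 0 = 0.
Proof. intros Hk. apply up_unique; lia. Qed.

Lemma up_1 (k y : Z) : 1 <= y <= k -> up k y = 1.
Proof. intros Hy. apply up_unique; lia. Qed.

(** For [Y = k * n + 1], the ceiling of [(Y - y) / k] is [n + 1] minus that of [y / k]. Hence the
    rectangle below such a corner has no defect. *)
Lemma up_add_sub (k Y y : Z) : 0 < k -> (k | Y - 1) -> up k y + up k (Y - y) = up k Y.
Proof.
  intros Hk [n HY]. pose proof (up_spec k y Hk) as Hy.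
  rewrite (up_unique k Y (n + 1)) by lia.
  rewrite (up_unique k (Y - y) (n + 1 - up k y)) by lia. ring.
Qed.

Lemma up_add_congr_1 (k Y x : Z) :
  0 < k -> (k | Y - 1) -> up k (Y + x) = up k Y - 1 + up k (1 + x).
Proof.
  intros Hk [n Hn]. replace (Y + x) with (1 + x + k * n) by lia.
  replace Y with (1 + k * n) by lia. rewrite !up_add_mul, (up_1 k 1) by lia. ring.
Qed.

(** * Costs, the L-shape and its lattice basis *)

Definition cost (a d c k y w : Z) : Z := a * up k y + d * y + c * w.

Definition lshape (s s' P P' y w : Z) : Prop :=
  0 <= y /\ 0 <= w /\ ((y < s - s' /\ w < P') \/ (y < s /\ w < P' - P)).

(* The vectors (s, -P) and (s', -P') span the lattice of all (y, w) such that
   d y + c w is divisible by a.  The numbers s + k t and s' + k t' are two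
   consecutive R_i in Rodseth's notation. *)
Record reduced_basis (a d c k s s' P P' t t' : Z) : Prop := {
  rb_s : d * s = c * P + a * t;
  rb_s' : d * s' = c * P' + a * t';
  rb_det : s * P' - s' * P = a;
  rb_s'_s : 0 <= s' < s;
  rb_P_P' : 0 <= P < P';
  rb_R : 0 < s + k * t;
  rb_R' : s' + k * t' <= 0 }.

(** Euclidean descent with quotients rounded up: the pair [s, s'] becomes [s', q * s' - s], which
    keeps the determinant, until [s' + k * t'] is no longer positive. *)
Lemma reduced_basis_exists (a d c k : Z) :
  0 < a -> 0 < d -> 0 < c -> 0 < k -> Z.gcd a d = 1 ->
  exists s s' P P' t t', reduced_basis a d c k s s' P P' t t'.
Proof.
  intros Ha Hd Hc Hk Hg.
  assert (Hdesc : forall N, 0 <= N -> forall s s' P P' t t', s' < N ->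
            d * s = c * P + a * t -> d * s' = c * P' + a * t' -> s * P' - s' * P = a ->
            0 <= s' < s -> 0 <= P < P' -> 0 < s + k * t ->
            exists s s' P P' t t', reduced_basis a d c k s s' P P' t t').
  { intros N HN. pattern N. apply natlike_ind; [lia| |exact HN]. clear N HN.
    intros N HN IH s s' P P' t t' Hlt E E' Edet Hs HP HR.
    destruct (Z_le_gt_dec (s' + k * t') 0) as [|HR'].
    - exists s, s', P, P', t, t'. now constructor.
    - assert (Hs' : 0 < s').
      (* If [s' = 0], then [a * t' = - c * P'] is negative, so the descent would have stopped. *)
      { destruct (Z.eq_dec s' 0) as [->|]; [exfalso|lia].
        assert (0 < t') by nia. assert (0 < c * P') by nia. nia. }
      set (q := up s' s). pose proof (up_spec s' s Hs') as Hq. fold q in Hq.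
      assert (2 <= q) by nia.
      apply (IH s' (q * s' - s) P' (q * P' - P) t' (q * t' - t)); nia. }
  destruct (Z.gcd_bezout a d 1 Hg) as (u & v & Huv).
  pose proof (Z.div_mod (c * v) a ltac:(lia)) as Hdm.
  pose proof (Z.mod_pos_bound (c * v) a Ha).
  set (s0 := (c * v) mod a) in *. set (n := c * v / a) in *. clearbody s0 n.
  assert (E0 : s0 = c * v - a * n) by lia.
  (* The start is the basis [(a, 0)], [(s0, -1)], where [d * s0] is congruent to [c] modulo [a]. *)
  apply (Hdesc a ltac:(lia) a s0 0 1 d (- c * u - d * n)); try lia.
  rewrite E0. transitivity (c * (v * d) - a * n * d); [ring|].
  replace (v * d) with (1 - u * a) by lia. ring.
Qed.

(** * The L-shape gives the Apéry set *)

Section AperySet.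
Variables a d c k s s' P P' t t' : Z.
Hypotheses (Ha : 0 < a) (Hd : 0 < d) (Hc : 0 < c) (Hk : 0 < k) (Hg : Z.gcd a d = 1).
Hypothesis B : reduced_basis a d c k s s' P P' t t'.

Notation ct := (cost a d c k).
Notation L := (lshape s s' P P').

(** A lattice translation changes [d y + c w] by a multiple of [a]; absorbed into the ceiling, it
    turns [s] and [s'] into [s + k * t] and [s' + k * t']. *)
Lemma cost_shift (y w i j : Z) :
  ct (y - i * s + j * s') (w + i * P - j * P') =
  ct y w + a * (up k (y - i * (s + k * t) + j * (s' + k * t')) - up k y).
Proof using Hk B.
  destruct B as [E E' _ _ _ _ _]. unfold cost.
  replace (y - i * s + j * s')
    with (y - i * (s + k * t) + j * (s' + k * t') + k * (i * t - j * t')) by ring.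
  rewrite up_add_mul by assumption.
  replace (d * (y - i * (s + k * t) + j * (s' + k * t') + k * (i * t - j * t')))
    with (d * y - i * (d * s) + j * (d * s')) by ring.
  rewrite E, E'. ring.
Qed.

Lemma lshape_reduce (y w : Z) :
  0 <= y -> 0 <= w -> exists y0 w0 m, L y0 w0 /\ 0 <= m /\ ct y w = ct y0 w0 + a * m.
Proof using Ha Hk B.
  destruct B as [_ _ Edet Hs HP HR HR'].
  intros Hy Hw.
  (* The moves [(1, 0)], [(0, 1)] and [(1, 1)] of [(i, j)] lower this linear form by [(i + j) * a],
     and the signs of [s + k * t] and [s' + k * t'] prevent the cost from rising. *)
  assert (Hind : forall N, 0 <= N -> forall y w, 0 <= y -> 0 <= w ->
            (P + P') * y + (s + s') * w < N ->
            exists y0 w0 m, L y0 w0 /\ 0 <= m /\ ct y w = ct y0 w0 + a * m).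
  { clear y w Hy Hw.
    intros N HN. pattern N. apply natlike_ind; [nia| |exact HN]. clear N HN.
    intros N HN IH y w Hy Hw Hlt.
    assert (Hstep : forall i j, 0 <= i -> 0 <= j -> 0 < i + j ->
              0 <= y - i * s + j * s' -> 0 <= w + i * P - j * P' ->
              exists y0 w0 m, L y0 w0 /\ 0 <= m /\ ct y w = ct y0 w0 + a * m).
    { intros i j Hi Hj Hij Hy' Hw'.
      destruct (IH _ _ Hy' Hw') as (y0 & w0 & m & HL & Hm & E).
      - replace ((P + P') * (y - i * s + j * s') + (s + s') * (w + i * P - j * P'))
          with ((P + P') * y + (s + s') * w - (i + j) * (s * P' - s' * P)) by ring.
        rewrite Edet. nia.
      - exists y0, w0, (m + (up k y - up k (y - i * (s + k * t) + j * (s' + k * t')))).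
        rewrite cost_shift in E. split; [assumption|split; [|lia]].
        pose proof (up_le k (y - i * (s + k * t) + j * (s' + k * t')) y Hk ltac:(nia)). lia. }
    destruct (Z_lt_ge_dec y s) as [Hys|Hys]; [|apply (Hstep 1 0); lia].
    destruct (Z_lt_ge_dec w P') as [HwP|HwP]; [|apply (Hstep 0 1); lia].
    destruct (Z_lt_ge_dec y (s - s')) as [Hy1|Hy1];
      [|destruct (Z_lt_ge_dec w (P' - P)) as [Hw1|Hw1]; [|apply (Hstep 1 1); lia]];
      (exists y, w, 0; split; [unfold lshape; lia|lia]). }
  apply (Hind ((P + P') * y + (s + s') * w + 1)); nia.
Qed.

(** Points with costs congruent modulo [a] differ by a lattice vector. Cramer's rule gives its
    coordinates [i], [j], and no nonzero lattice vector joins two points of the L-shape. *)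
Lemma lshape_unique (y w y0 w0 m : Z) :
  L y w -> L y0 w0 -> ct y w = ct y0 w0 + a * m -> y = y0 /\ w = w0.
Proof using Ha Hk Hg B.
  destruct B as [Es Es' Edet Hs HP _ _]. unfold cost. intros HL HL0 E.
  assert (E1 : d * (y - y0) = a * (m + up k y0 - up k y) - c * (w - w0)) by lia.
  assert (Di : (a | (y - y0) * P' + (w - w0) * s')).
  { apply Z.gauss with d; [|exact Hg].
    exists ((m + up k y0 - up k y) * P' + (w - w0) * t').
    transitivity (d * (y - y0) * P' + (w - w0) * (d * s')); [ring|]. rewrite E1, Es'. ring. }
  assert (Dj : (a | (y - y0) * P + (w - w0) * s)).
  { apply Z.gauss with d; [|exact Hg].
    exists ((m + up k y0 - up k y) * P + (w - w0) * t).
    transitivity (d * (y - y0) * P + (w - w0) * (d * s)); [ring|]. rewrite E1, Es. ring. }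
  destruct Di as [i Hi], Dj as [j Hj].
  assert (Ey : y - y0 = i * s - j * s').
  { apply Z.mul_reg_l with a; [lia|].
    transitivity (s * (i * a) - s' * (j * a)); [|ring]. rewrite <- Hi, <- Hj, <- Edet. ring. }
  assert (Ew : w - w0 = j * P' - i * P).
  { apply Z.mul_reg_l with a; [lia|].
    transitivity (P' * (j * a) - P * (i * a)); [|ring]. rewrite <- Hi, <- Hj, <- Edet. ring. }
  unfold lshape in *.
  destruct (Z.lt_trichotomy i j) as [H|[<-|H]].
  - exfalso. destruct (Z_le_gt_dec j 0); [|destruct (Z_le_gt_dec i 0)]; nia.
  - destruct (Z.lt_trichotomy i 0) as [H|[->|H]]; [exfalso; nia|lia|exfalso; nia].
  - exfalso. destruct (Z_le_gt_dec i 0); [|destruct (Z_le_gt_dec j 0)]; nia.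
Qed.

Lemma lshape_rep (z : Z) : exists y w m, L y w /\ z = ct y w + a * m.
Proof using Ha Hk Hg B.
  destruct (Z.gcd_bezout a d 1 Hg) as (u & v & Huv).
  pose proof (Z.div_mod (z * v) a ltac:(lia)) as Hdm.
  pose proof (Z.mod_pos_bound (z * v) a Ha).
  destruct (lshape_reduce ((z * v) mod a) 0) as (y & w & m & HL & _ & E); [lia|lia|].
  exists y, w, (z * u + d * (z * v / a) + m - up k ((z * v) mod a)). split; [assumption|].
  transitivity (ct ((z * v) mod a) 0
    + a * (z * u + d * (z * v / a) - up k ((z * v) mod a))); [|rewrite E; ring].
  unfold cost. transitivity (z * (u * a + v * d)); [rewrite Huv; ring|].
  transitivity (a * (z * u) + d * (z * v)); [ring|]. rewrite Hdm at 1. ring.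
Qed.

(** Reducing any representation into the L-shape never raises the cost, and uniqueness makes it end
    at [(y, w)]; so the cost is least in its class modulo [a]. *)
Lemma ap_sg_lshape (y w m : Z) : L y w -> (ap_sg a d c k (ct y w + a * m) <-> 0 <= m).
Proof using Ha Hk Hg B.
  intros HL. split.
  - intros (n & y1 & w1 & Hn & Hy1 & Hw1 & E).
    destruct (lshape_reduce y1 w1) as (y0 & w0 & m0 & HL0 & Hm0 & E0); [lia|lia|].
    pose proof (up_spec k y1 Hk).
    assert (0 <= n - up k y1) by nia.
    assert (E1 : ct y w = ct y0 w0 + a * (m0 + (n - up k y1) - m)).
    { unfold cost in *. lia. }
    destruct (lshape_unique _ _ _ _ _ HL HL0 E1) as [-> ->]. nia.
  - intros Hm. unfold lshape in HL. pose proof (up_spec k y Hk).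
    exists (up k y + m), y, w. unfold cost. repeat split; try lia; nia.
Qed.

(** * Pseudo-symmetry as a pairing of costs *)

(** Both [F] and [F / 2] are the largest gaps of their classes modulo [a], hence of the form cost
    minus [a], at [(Y, W)] and [(y0, w0)]. The number [e] is the defect. *)
Lemma pseudo_symmetric_elim :
  pseudo_symmetric (ap_sg a d c k) ->
  exists Y W y0 w0, L Y W /\ L y0 w0 /\
    (forall y w, L y w -> ct y w <= ct Y W) /\
    (forall y w y1 w1 e, L y w -> L y1 w1 -> ct y w + ct y1 w1 = ct Y W + a * e ->
      (y = y0 /\ w = w0 /\ e = 1) \/ (~ (y = y0 /\ w = w0) /\ e = 0)).
Proof using Ha Hk Hg B.
  intros (F & (HF & HFgt) & [h Hh] & HPS).
  assert (Eh : F / 2 = h) by (rewrite Hh, Z.mul_comm; apply Z.div_mul; lia).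
  rewrite Eh in HPS.
  assert (Hhn : ~ ap_sg a d c k h) by (intros H; specialize (HPS h); tauto).
  destruct (lshape_rep F) as (Y & W & m & HL & EF).
  assert (Em : m = -1).
  { rewrite EF, ap_sg_lshape in HF by assumption.
    pose proof (HFgt (F + a) ltac:(lia)) as H.
    replace (F + a) with (ct Y W + a * (m + 1)) in H by lia.
    rewrite ap_sg_lshape in H by assumption. lia. }
  destruct (lshape_rep h) as (y0 & w0 & m0 & HL0 & Eh0).
  assert (Em0 : m0 = -1).
  { rewrite Eh0, ap_sg_lshape in Hhn by assumption.
    destruct (proj2 (HPS (h + a)) ltac:(lia)) as [H|(x & H & Ex)].
    - replace (h + a) with (ct y0 w0 + a * (m0 + 1)) in H by lia.
      rewrite ap_sg_lshape in H by assumption. lia.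
    - replace x with (ct y0 w0 + a * (m0 - 1)) in H by lia.
      rewrite ap_sg_lshape in H by assumption. lia. }
  subst m m0.
  assert (Hns : forall y w, L y w -> ~ ap_sg a d c k (ct y w + a * (-1))).
  { intros y w HLyw H. rewrite ap_sg_lshape in H by assumption. lia. }
  exists Y, W, y0, w0. split; [assumption|split; [assumption|split]].
  - intros y w HLyw. destruct (Z_le_gt_dec (ct y w) (ct Y W)); [assumption|exfalso].
    apply (Hns y w HLyw), HFgt. lia.
  - intros y w y1 w1 e HL1 HL2 E.
    destruct (Z.eq_dec (ct y w) (ct y0 w0)) as [E0|E0]; [left|right].
    + destruct (lshape_unique y w y0 w0 0 HL1 HL0 ltac:(lia)) as [-> ->].
      destruct (lshape_unique y1 w1 y0 w0 (e - 1) HL2 HL0 ltac:(lia)) as [-> ->].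
      repeat split. nia.
    + split; [intros [-> ->]; lia|].
      assert (e <= 0).
      { destruct (proj2 (HPS (ct y w + a * (-1))) ltac:(lia)) as [H|(x & H & Ex)].
        - now apply Hns in H.
        - replace x with (ct y1 w1 + a * (- e)) in H by lia.
          rewrite ap_sg_lshape in H by assumption. lia. }
      (* A negative defect would make [F] a sum of two elements of the semigroup. *)
      destruct (Z.eq_dec e 0) as [|He]; [assumption|exfalso]. apply HF.
      replace F with ((ct y w + a * 0) + (ct y1 w1 + a * (- e - 1))) by lia.
      apply ap_sg_add; apply ap_sg_lshape; auto; lia.
Qed.

Lemma pseudo_symmetric_intro (Y W y0 w0 : Z) :
  L Y W -> 1 <= Y -> L y0 w0 -> 2 * ct y0 w0 = ct Y W + a ->
  (forall y w, L y w ->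
     (y = y0 /\ w = w0) \/ exists y1 w1, L y1 w1 /\ ct y w + ct y1 w1 = ct Y W) ->
  pseudo_symmetric (ap_sg a d c k).
Proof using Ha Hd Hc Hk Hg B.
  intros HL HY HL0 E0 Hinv.
  assert (Hpos : forall y w, L y w -> 0 <= ct y w).
  { intros y w (Hy & Hw & _). pose proof (up_le k 0 y Hk Hy). rewrite up_0 in H by assumption.
    unfold cost. nia. }
  (* This makes the Frobenius number nonnegative, hence at least its half; so numbers above it in
     the class of [(y0, w0)] are in the semigroup. *)
  assert (HM : a <= ct Y W).
  { destruct HL as (_ & Hw & _). pose proof (up_le k 1 Y Hk HY).
    rewrite up_1 in H by lia. unfold cost. nia. }
  assert (Eh : (ct Y W + a * (-1)) / 2 = ct y0 w0 + a * (-1)).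
  { replace (ct Y W + a * (-1)) with ((ct y0 w0 + a * (-1)) * 2) by lia.
    apply Z.div_mul. lia. }
  exists (ct Y W + a * (-1)). split; [split|split].
  - rewrite ap_sg_lshape by assumption. lia.
  - intros z Hz. destruct (lshape_rep z) as (y & w & m & HL1 & ->).
    apply ap_sg_lshape; [assumption|].
    destruct (Hinv y w HL1) as [[-> ->]|(y1 & w1 & HL2 & E)].
    + nia.
    + specialize (Hpos _ _ HL2). nia.
  - exists (ct y0 w0 - a). lia.
  - intros z. rewrite Eh. destruct (lshape_rep z) as (y & w & m & HL1 & ->).
    destruct (Hinv y w HL1) as [[-> ->]|(y1 & w1 & HL2 & E)].
    (* In this class reflection sends [m] to [- m - 2], so both are negative only for [m = -1],
       which is half the Frobenius number. *)
    + split.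
      * rewrite ap_sg_lshape by assumption. intros [H|(x & H & Ex)]; [nia|].
        replace x with (ct y0 w0 + a * (- m - 2)) in H by lia.
        rewrite ap_sg_lshape in H by assumption. nia.
      * intros H. destruct (Z_le_gt_dec 0 m); [left|right].
        -- now apply ap_sg_lshape.
        -- exists (ct y0 w0 + a * (- m - 2)). split; [|lia].
           apply ap_sg_lshape; [assumption|]. assert (m <> -1) by (intros ->; lia). lia.
    + split.
      * intros _ H.
        destruct (lshape_unique y w y0 w0 (-1 - m) HL1 HL0 ltac:(lia)) as [-> ->].
        destruct (lshape_unique y1 w1 y0 w0 (-1) HL2 HL0 ltac:(lia)) as [-> ->]. lia.
      * intros _. destruct (Z_le_gt_dec 0 m); [left|right].
        -- now apply ap_sg_lshape.
        -- exists (ct y1 w1 + a * (- m - 1)). split; [|lia].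
           apply ap_sg_lshape; [assumption|lia].
Qed.

(** * Classification of the possible shapes *)

(** The complement of a point at the corner may leave the L-shape; a lattice translation brings it
    back, and the coefficient of [a] is the defect. *)
Lemma cost_compl (Y W y w i j : Z) :
  ct y w + ct (Y - y - i * s + j * s') (W - w + i * P - j * P') =
  ct Y W + a * (up k y + up k (Y - y - i * (s + k * t) + j * (s' + k * t')) - up k Y).
Proof using Hk B. rewrite cost_shift. unfold cost. ring. Qed.

(* The six shapes give, in this order, the cases (a), (b), (c.1) or (c.2), (d), (e) and (f). *)
Lemma pseudo_symmetric_basis :
  2 <= k -> pseudo_symmetric (ap_sg a d c k) ->
  (s = 3 /\ P = 0 /\ P' = 1) \/
  (s = 3 /\ s' = 2 /\ P' = P + 1 /\ t' = -1) \/
  (3 <= s /\ s' = 1 /\ P' = P + 1 /\ s + k * t = 3) \/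
  (2 * k + 1 <= s /\ s' = 2 * k - 1 /\ P' = P + 1 /\ s + k * t = 1) \/
  (2 <= s /\ s' = s - 1 /\ P = 1 /\ s' + k * t' = 1 - 2 * k) \/
  (3 <= s /\ s' = s - 3 /\ P = 1 /\ s' + k * t' = -1).
Proof using Ha Hd Hc Hk Hg B.
  intros Hk2 HPS.
  destruct (pseudo_symmetric_elim HPS) as (Y & W & y0 & w0 & HL & HL0 & Hmax & H).
  clear HPS.
  assert (Hy1 : forall x, 1 <= x <= k -> up k x = 1) by (intros; now apply up_1).
  pose proof (up_0 k Hk) as Hu0.
  assert (HupS : forall x, up k x <= up k (x + 1)) by (intros; apply up_le; lia).
  pose proof B as [_ _ Edet Hs HP HR HR'].
  assert (Hcorner : (Y = s - s' - 1 /\ W = P' - 1) \/ (Y = s - 1 /\ W = P' - P - 1)).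
  { assert (Hr : ~ L (Y + 1) W).
    { intros HLr. specialize (Hmax _ _ HLr). specialize (HupS Y). unfold cost in Hmax. nia. }
    assert (Ht : ~ L Y (W + 1)).
    { intros HLt. specialize (Hmax _ _ HLt). unfold cost in Hmax. nia. }
    unfold lshape in *. lia. }
  assert (Hrect : forall y w, 0 <= y <= Y -> 0 <= w <= W ->
            (y = y0 /\ w = w0 /\ up k y + up k (Y - y) - up k Y = 1) \/
            (~ (y = y0 /\ w = w0) /\ up k y + up k (Y - y) - up k Y = 0)).
  { intros y w Hy Hw. apply (H y w (Y - y) (W - w)); try (unfold lshape in *; lia).
    unfold cost. ring. }
  assert (HY0 : 0 <= Y) by (unfold lshape in HL; lia).
  assert (HW0 : 0 <= W) by (unfold lshape in HL; lia).
  assert (HL0' := HL0). unfold lshape in HL0'.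
  assert (HY : (Y = 0 \/ (k | Y - 1)) \/ (Y = 2 /\ W = 0 /\ y0 = 1 /\ w0 = 0)).
  { destruct (Z.eq_dec Y 0) as [|HYn]; [auto|].
    pose proof (Z.div_mod (Y - 1) k ltac:(lia)) as Hdm.
    pose proof (Z.mod_pos_bound (Y - 1) k Hk).
    destruct (Z.eq_dec ((Y - 1) mod k) 0) as [Hr|Hr].
    { left; right. now apply Z.mod_divide; [lia|]. }
    right. set (n := (Y - 1) / k) in *. set (r := (Y - 1) mod k) in *. clearbody n r.
    assert (0 <= n) by nia. assert (2 <= Y) by nia.
    assert (E1 : up k (Y - 1) = n + 1) by (apply up_unique; lia).
    assert (E2 : up k Y = n + 1) by (apply up_unique; lia).
    assert (E3 := Hy1 1 ltac:(lia)).
    (* If [Y] is neither 0 nor 1 modulo [k], the defect is 1 at these three points, so they must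
       coincide. *)
    pose proof (Hrect 1 0). pose proof (Hrect 1 W). pose proof (Hrect (Y - 1) 0) as Hr3.
    replace (Y - (Y - 1)) with 1 in Hr3 by ring. lia. }
  assert (Hout : Y = 0 \/ (k | Y - 1) -> ~ (y0 <= Y /\ w0 <= W)).
  { intros HYd Hin. specialize (Hrect y0 w0).
    assert (E : up k y0 + up k (Y - y0) = up k Y).
    { destruct HYd as [->|HYd]; [|now apply up_add_sub].
      replace y0 with 0 by lia. change (0 - 0) with 0. lia. }
    lia. }
  assert (HYp : (k | Y - 1) -> 1 <= Y).
  { intros HYd. pose proof (divide_small k (Y - 1) HYd). lia. }
  destruct Hcorner as [[EY EW]|[EY EW]].
  - (* the complement of the rectangle at the corner is [s - s', s) x [0, P' - P) *)
    assert (HA : forall y w, s - s' <= y < s -> 0 <= w < P' - P ->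
            (y = y0 /\ w = w0 /\ up k y + up k (Y - y + (s + k * t)) - up k Y = 1) \/
            (~ (y = y0 /\ w = w0) /\ up k y + up k (Y - y + (s + k * t)) - up k Y = 0)).
    { intros y w Hy Hw. pose proof (cost_compl Y W y w (-1) 0) as E.
      refine (H y w _ _ _ _ _ (eq_trans E _)); try (unfold lshape; lia).
      do 5 f_equal. ring. }
    assert (Hsd : s - s' - 1 = Y) by lia.
    destruct HY as [HY|(EY2 & EW2 & _)].
    + specialize (Hout HY).
      (* The defect does not depend on [w], so a single exception forces a single row. *)
      assert (HP1 : P' = P + 1).
      { pose proof (HA y0 w0). pose proof (HA y0 0). pose proof (HA y0 (P' - P - 1)). lia. }
      assert (Hw00 : w0 = 0) by lia.
      (* The reflection of [y] to [Y + s - y] preserves the defect and therefore fixes the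
         exception. *)
      assert (Hy0 : 2 * y0 = Y + s).
      { pose proof (HA y0 0 ltac:(lia) ltac:(lia)) as HA1.
        pose proof (HA (Y + s - y0) 0 ltac:(lia) ltac:(lia)) as HA2.
        assert (E1 : up k (Y - y0 + (s + k * t)) = up k (Y + s - y0) + t)
          by (rewrite <- up_add_mul by assumption; f_equal; ring).
        assert (E2 : up k (Y - (Y + s - y0) + (s + k * t)) = up k y0 + t)
          by (rewrite <- up_add_mul by assumption; f_equal; ring).
        lia. }
      destruct HY as [HY|HY].
      (* At [y = 1] the defect is at least 1, so [y0 = 1] and [s = 2]; then [s + k * t = 1]
         contradicts [k >= 2]. *)
      * exfalso. pose proof (HA 1 0 ltac:(lia) ltac:(lia)) as HA1.
        rewrite (Hy1 1) in HA1 by lia.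
        replace (Y - 1 + (s + k * t)) with (s + k * t - 1) in HA1 by lia.
        pose proof (up_spec k (s + k * t - 1) Hk) as Hup.
        assert (0 <= up k (s + k * t - 1)) by nia.
        rewrite HY, Hu0 in HA1. assert (Es : s = 2) by lia.
        replace (up k (s + k * t - 1)) with 0 in * by lia.
        clear - Hk2 HR Hup Es.
        assert (k * t = -1) by lia. assert (t < 0) by nia. nia.
      * assert (HE : forall u, up k (Y + u) + up k (Y - (Y + u) + (s + k * t)) - up k Y =
                   up k (1 + u) + up k (s + k * t - u) - 1).
        { intros u. rewrite up_add_congr_1 by assumption.
          replace (Y - (Y + u) + (s + k * t)) with (s + k * t - u) by ring. ring. }
        assert (HA' : forall u, 1 <= u <= s' ->
          (Y + u = y0 /\ up k (1 + u) + up k (s + k * t - u) = 2) \/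
          (Y + u <> y0 /\ up k (1 + u) + up k (s + k * t - u) = 1)).
        { intros u Hu. specialize (HE u). pose proof (HA (Y + u) 0). lia. }
        clear HA HE.
        specialize (HYp HY).
        assert (E1 : up k (1 + 1) = 1) by (apply Hy1; lia).
        destruct (Z.eq_dec s' 1) as [Hs1|Hs1].
        -- right; right; left. split; [lia|]. split; [assumption|]. split; [assumption|].
           destruct (HA' 1 ltac:(lia)) as [[_ E]|[E _]]; [|lia].
           pose proof (up_spec k (s + k * t - 1) Hk).
           replace (up k (s + k * t - 1)) with 1 in * by lia.
           destruct HY as [n Hn].
           assert (s + k * t - 3 = 0); [|lia].
           apply (divide_small k); [exists (n + t)|]; lia.
        -- right; right; right; left.
           assert (ER : s + k * t = 1).
           { destruct (HA' 1 ltac:(lia)) as [[E _]|[_ E]]; [lia|].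
             pose proof (up_spec k (s + k * t - 1) Hk). nia. }
           rewrite ER in HA'.
           (* Now the defect at offset [u] first equals 1 at [u = k] and again at [u = 2 * k]. The
              exception is thus [u = k], and being the middle of the row it gives
              [s' = 2 * k - 1]. *)
           assert (Hsm : forall u, 1 <= u < k -> up k (1 + u) + up k (1 - u) = 1).
           { intros u Hu. rewrite (Hy1 (1 + u)) by lia. rewrite (up_unique k (1 - u) 0); lia. }
           assert (Hk1 : up k (1 + k) + up k (1 - k) = 2).
           { rewrite (up_unique k (1 + k) 2), (up_unique k (1 - k) 0); lia. }
           assert (Hk3 : up k (1 + 2 * k) + up k (1 - 2 * k) = 2).
           { rewrite (up_unique k (1 + 2 * k) 3), (up_unique k (1 - 2 * k) (-1)); lia. }
           assert (k <= s').
           { pose proof (HA' (y0 - Y)). specialize (Hsm (y0 - Y)). lia. }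
           pose proof (HA' k). pose proof (HA' (2 * k)).
           assert (s' = 2 * k - 1) by lia.
           lia.
    + assert (P = 0) by lia. assert (P' = 1) by lia.
      left. repeat split; try assumption.
      destruct (Z_lt_ge_dec 0 s') as [Hs0|]; [exfalso|lia].
      assert (HL3 : L 3 0) by (unfold lshape; lia). specialize (Hmax _ _ HL3).
      rewrite EY2, EW2 in Hmax. unfold cost in Hmax. pose proof (up_le k 2 3 Hk). nia.
  - (* the complement of the rectangle at the corner is [0, s - s') x [P' - P, P') *)
    assert (HB : forall y w, 0 <= y < s - s' -> P' - P <= w < P' ->
            (y = y0 /\ w = w0 /\ up k y + up k (Y - (s' + k * t') - y) - up k Y = 1) \/
            (~ (y = y0 /\ w = w0) /\ up k y + up k (Y - (s' + k * t') - y) - up k Y = 0)).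
    { intros y w Hy Hw. pose proof (cost_compl Y W y w 0 (-1)) as E.
      refine (H y w _ _ _ _ _ (eq_trans E _)); try (unfold lshape; lia).
      do 5 f_equal. ring. }
    destruct HY as [HY|(EY2 & EW2 & Ey0 & Ew0)].
    + specialize (Hout HY).
      assert (HP1 : P = 1).
      { pose proof (HB y0 w0). pose proof (HB y0 (P' - P)). pose proof (HB y0 (P' - 1)). lia. }
      assert (Hy0 : 2 * y0 = s - s' - 1).
      { pose proof (HB y0 w0 ltac:(lia) ltac:(lia)) as HB1.
        pose proof (HB (s - s' - 1 - y0) w0 ltac:(lia) ltac:(lia)) as HB2.
        assert (E1 : up k (Y - (s' + k * t') - y0) = up k (s - s' - 1 - y0) + - t')
          by (rewrite <- up_add_mul by assumption; f_equal; lia).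
        assert (E2 : up k (Y - (s' + k * t') - (s - s' - 1 - y0)) = up k y0 + - t')
          by (rewrite <- up_add_mul by assumption; f_equal; lia).
        lia. }
      destruct HY as [HY|HY].
      * exfalso. assert (HLm : L 0 (W + 1)) by (unfold lshape; lia).
        specialize (Hmax _ _ HLm). rewrite HY in Hmax. unfold cost in Hmax. nia.
      * assert (HB' : forall y, 0 <= y < s - s' ->
          (y = y0 /\ up k y + up k (1 - (s' + k * t') - y) = 2) \/
          (y <> y0 /\ up k y + up k (1 - (s' + k * t') - y) = 1)).
        { intros y Hy. pose proof (up_add_congr_1 k Y (- (s' + k * t') - y) Hk HY) as E.
          replace (Y + (- (s' + k * t') - y)) with (Y - (s' + k * t') - y) in E by ring.
          replace (1 + (- (s' + k * t') - y)) with (1 - (s' + k * t') - y) in E by ring.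
          pose proof (HB y w0). lia. }
        clear HB.
        specialize (HYp HY).
        destruct (HB' 0 ltac:(lia)) as [[E0 E]|[E0 E]].
        -- right; right; right; right; left.
           rewrite Hu0, Z.sub_0_r in E. pose proof (up_spec k (1 - (s' + k * t')) Hk).
           replace (up k (1 - (s' + k * t'))) with 2 in * by lia.
           destruct HY as [n Hn]. assert (s' + k * t' - (1 - 2 * k) = 0).
           { apply (divide_small k); [exists (n + t' + 2)|]; lia. }
           lia.
        -- do 5 right. rewrite Hu0, Z.sub_0_r in E.
           pose proof (up_spec k (1 - (s' + k * t')) Hk).
           replace (up k (1 - (s' + k * t'))) with 1 in * by lia.
           (* If this number is 0, the defect vanishes at [y0] too. Otherwise it is positive at
              [y = 1], so [y0 = 1] and the row has three points. *)
           destruct (Z.eq_dec (s' + k * t') 0) as [ER|ER].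
           { exfalso. pose proof (up_add_sub k Y y0 Hk HY) as E1.
             replace (Y - y0) with (Y + - y0) in E1 by ring.
             rewrite up_add_congr_1 in E1 by assumption.
             replace (1 + - y0) with (1 - (s' + k * t') - y0) in E1 by lia.
             pose proof (HB' y0). lia. }
           assert (E2 := HB' 1 ltac:(lia)).
           replace (1 - (s' + k * t') - 1) with (- (s' + k * t')) in E2 by ring.
           pose proof (up_spec k (- (s' + k * t')) Hk).
           assert (1 <= up k (- (s' + k * t'))) by nia.
           rewrite (Hy1 1) in E2 by lia.
           assert (y0 = 1) by lia. destruct HY as [n Hn].
           assert (s' + k * t' - (-1) = 0); [|lia].
           apply (divide_small k); [exists (n + t')|]; lia.
    + assert (s = 3) by lia. assert (HP1 : P' = P + 1) by lia.
      destruct (Z.eq_dec P 0) as [HP0|HP0]; [left; lia|right; left].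
      assert (E2 : up k 2 = 1) by (apply Hy1; lia).
      rewrite EY2, E2 in HB.
      assert (E0 := HB 0 1 ltac:(lia) ltac:(lia)). rewrite Hu0, Z.sub_0_r in E0.
      pose proof (up_spec k (2 - (s' + k * t')) Hk).
      replace (up k (2 - (s' + k * t'))) with 1 in * by lia.
      (* For [s' < 2] the point [(1, 1)] would be a second exception besides [(1, 0)]. *)
      assert (Hs2 : s' = 2).
      { destruct (Z.eq_dec s' 2) as [|Hs2]; [assumption|exfalso].
        assert (E1 := HB 1 1 ltac:(lia) ltac:(lia)). rewrite (Hy1 1) in E1 by lia.
        pose proof (up_spec k (2 - (s' + k * t') - 1) Hk).
        assert (1 <= up k (2 - (s' + k * t') - 1)) by nia. lia. }
      repeat split; try lia. nia.
Qed.

(** * The shapes are pseudo-symmetric *)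

(** The rectangle below the corner pairs with itself. The rest is one row, reflected by [y] to
    [Y + s - y], with fixed point [y0]. *)
Lemma pseudo_symmetric_corner_left (y0 : Z) :
  P' = P + 1 -> 2 <= s - s' -> (k | s - s' - 1 - 1) -> s - s' <= y0 < s ->
  2 * y0 = s - s' - 1 + s ->
  up k y0 + up k (s - s' - 1 - y0 + (s + k * t)) = up k (s - s' - 1) + 1 ->
  (forall y, s - s' <= y < s -> y <> y0 ->
     up k y + up k (s - s' - 1 - y + (s + k * t)) = up k (s - s' - 1)) ->
  pseudo_symmetric (ap_sg a d c k).
Proof using Ha Hd Hc Hk Hg B.
  intros EP Hs2 Hdvd Hy0 Ey0 E0 Erest. set (Y := s - s' - 1) in *.
  pose proof B as [_ _ _ Hs HP _ _].
  assert (HA : forall y, ct y 0 + ct (Y + s - y) 0 =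
            ct Y P + a * (up k y + up k (Y - y + (s + k * t)) - up k Y)).
  { intros y. pose proof (cost_compl Y P y 0 (-1) 0) as E.
    replace (Y - y - -1 * s + 0 * s') with (Y + s - y) in E by ring.
    replace (P - 0 + -1 * P - 0 * P') with 0 in E by ring.
    rewrite E. do 5 f_equal. ring. }
  apply (pseudo_symmetric_intro Y P y0 0).
  - unfold lshape. lia.
  - lia.
  - unfold lshape. lia.
  - specialize (HA y0). replace (Y + s - y0) with y0 in HA by lia. rewrite E0 in HA. lia.
  - intros y w HL. destruct (Z_le_gt_dec y Y) as [HyY|HyY]; [right|].
    + exists (Y - y), (P - w). split; [unfold lshape in *; lia|].
      pose proof (up_add_sub k Y y Hk Hdvd). unfold cost. nia.
    + assert (Hy : s - s' <= y < s) by (unfold lshape in HL; lia).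
      assert (w = 0) as -> by (unfold lshape in HL; lia).
      destruct (Z.eq_dec y y0) as [->|Hne]; [left; auto|right].
      exists (Y + s - y), 0. split; [unfold lshape in *; lia|].
      rewrite HA, Erest by assumption. ring.
Qed.

(** Here the remaining row is the top one, [w = P' - 1], reflected by [y] to [Y - s' - y]. *)
Lemma pseudo_symmetric_corner_right (y0 : Z) :
  P = 1 -> 2 <= s -> (k | s - 1 - 1) -> 0 <= y0 < s - s' ->
  2 * y0 = s - s' - 1 ->
  up k y0 + up k (s - 1 - y0 - (s' + k * t')) = up k (s - 1) + 1 ->
  (forall y, 0 <= y < s - s' -> y <> y0 ->
     up k y + up k (s - 1 - y - (s' + k * t')) = up k (s - 1)) ->
  pseudo_symmetric (ap_sg a d c k).
Proof using Ha Hd Hc Hk Hg B.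
  intros EP Hs2 Hdvd Hy0 Ey0 E0 Erest. set (Y := s - 1) in *.
  pose proof B as [_ _ _ Hs HP _ _].
  assert (HB : forall y, ct y (P' - 1) + ct (Y - s' - y) (P' - 1) =
            ct Y (P' - 2) + a * (up k y + up k (Y - y - (s' + k * t')) - up k Y)).
  { intros y. pose proof (cost_compl Y (P' - 2) y (P' - 1) 0 (-1)) as E.
    replace (Y - y - 0 * s + -1 * s') with (Y - s' - y) in E by ring.
    replace (P' - 2 - (P' - 1) + 0 * P - -1 * P') with (P' - 1) in E by ring.
    rewrite E. do 5 f_equal. ring. }
  apply (pseudo_symmetric_intro Y (P' - 2) y0 (P' - 1)).
  - unfold lshape. lia.
  - lia.
  - unfold lshape. lia.
  - specialize (HB y0). replace (Y - s' - y0) with y0 in HB by lia. rewrite E0 in HB. lia.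
  - intros y w HL. destruct (Z_le_gt_dec w (P' - 2)) as [HwW|HwW]; [right|].
    + exists (Y - y), (P' - 2 - w). split; [unfold lshape in *; lia|].
      pose proof (up_add_sub k Y y Hk Hdvd). unfold cost. nia.
    + assert (Hy : 0 <= y < s - s') by (unfold lshape in HL; lia).
      assert (w = P' - 1) as -> by (unfold lshape in HL; lia).
      destruct (Z.eq_dec y y0) as [->|Hne]; [left; auto|right].
      exists (Y - s' - y), (P' - 1). split; [unfold lshape in *; lia|].
      rewrite HB, Erest by assumption. ring.
Qed.

(** The L-shape is a hook with corner [(2, 0)]. Since [c * P' = 2 * d + a] is the cost of that
    corner, [(0, w)] pairs with [(0, P' - w)]; the exception is [(1, 0)]. *)
Lemma pseudo_symmetric_basis_b :
  2 <= k -> s = 3 -> s' = 2 -> P' = P + 1 -> t' = -1 -> pseudo_symmetric (ap_sg a d c k).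
Proof using Ha Hd Hc Hk Hg B.
  intros Hk2 Es Es' EP Et'. pose proof B as [_ EcP _ _ HP _ _].
  rewrite Es', Et' in EcP.
  pose proof (up_0 k Hk) as Hu0. pose proof (up_1 k 1 ltac:(lia)) as Hu1.
  pose proof (up_1 k 2 ltac:(lia)) as Hu2.
  apply (pseudo_symmetric_intro 2 0 1 0); try (unfold lshape; lia).
  - unfold cost. rewrite Hu1, Hu2. ring.
  - intros y w HL. unfold lshape in HL. rewrite Es, Es', EP in HL.
    destruct (Z.eq_dec w 0) as [->|Hw].
    + assert (y = 0 \/ y = 1 \/ y = 2) as [->|[->| ->]] by lia; [right|left|right].
      * exists 2, 0. split; [unfold lshape; lia|]. unfold cost. rewrite Hu0. ring.
      * lia.
      * exists 0, 0. split; [unfold lshape; lia|]. unfold cost. rewrite Hu0. ring.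
    + right. assert (y = 0) as -> by lia. exists 0, (P' - w).
      split; [unfold lshape; lia|]. unfold cost. rewrite Hu0, Hu2. lia.
Qed.

Lemma pseudo_symmetric_basis_c :
  2 <= k -> 3 <= s -> s' = 1 -> P' = P + 1 -> s + k * t = 3 -> pseudo_symmetric (ap_sg a d c k).
Proof using Ha Hd Hc Hk Hg B.
  intros Hk2 Hs Es' EP ER.
  assert (Hdvd : (k | s - s' - 1 - 1)) by (exists (- t); lia).
  apply (pseudo_symmetric_corner_left (s - 1)); try (assumption || lia).
  rewrite ER, Es'. replace (s - 1 - 1 - (s - 1) + 3) with 2 by ring.
  replace (s - 1) with ((s - 1 - 1) + 1) at 1 by ring.
  rewrite up_add_congr_1, !(up_1 k (1 + 1)), (up_1 k 2)
    by (assumption || lia || (exists (- t); lia)).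
  ring.
Qed.

Lemma pseudo_symmetric_basis_d :
  2 <= k -> 2 * k + 1 <= s -> s' = 2 * k - 1 -> P' = P + 1 -> s + k * t = 1 ->
  pseudo_symmetric (ap_sg a d c k).
Proof using Ha Hd Hc Hk Hg B.
  intros Hk2 Hs Es' EP ER. set (Y := s - s' - 1).
  assert (Hdvd : (k | Y - 1)) by (exists (- t - 2); lia).
  assert (HE : forall u, up k (Y + u) + up k (Y - (Y + u) + (s + k * t)) =
               up k Y - 1 + (up k (1 + u) + up k (1 - u))).
  { intros u. rewrite up_add_congr_1, ER by assumption.
    replace (Y - (Y + u) + 1) with (1 - u) by ring. ring. }
  (* At offset [u] from [Y], one ceiling jumps up at [u = k] and the other down at [u = k + 1]; only
     the middle point has a defect. *)
  apply (pseudo_symmetric_corner_left (Y + k)); fold Y; try (assumption || lia).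
  - rewrite HE, (up_unique k (1 + k) 2), (up_unique k (1 - k) 0) by lia. ring.
  - intros y Hy Hne. replace y with (Y + (y - Y)) by ring. rewrite HE.
    set (u := y - Y) in *.
    destruct (Z_lt_ge_dec u k).
    + rewrite (up_unique k (1 + u) 1), (up_unique k (1 - u) 0) by lia. ring.
    + rewrite (up_unique k (1 + u) 2), (up_unique k (1 - u) (-1)) by lia. ring.
Qed.

Lemma pseudo_symmetric_basis_e :
  2 <= s -> s' = s - 1 -> P = 1 -> s' + k * t' = 1 - 2 * k -> pseudo_symmetric (ap_sg a d c k).
Proof using Ha Hd Hc Hk Hg B.
  intros Hs Es' EP ER.
  assert (Hdvd : (k | s - 1 - 1)) by (exists (- t' - 2); lia).
  apply (pseudo_symmetric_corner_right 0); try (assumption || lia).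
  rewrite ER, up_0 by assumption.
  replace (s - 1 - 0 - (1 - 2 * k)) with (s - 1 + (2 * k - 1)) by ring.
  rewrite up_add_congr_1, (up_unique k (1 + (2 * k - 1)) 2) by (assumption || lia). ring.
Qed.

Lemma pseudo_symmetric_basis_f :
  2 <= k -> 3 <= s -> s' = s - 3 -> P = 1 -> s' + k * t' = -1 -> pseudo_symmetric (ap_sg a d c k).
Proof using Ha Hd Hc Hk Hg B.
  intros Hk2 Hs Es' EP ER.
  assert (Hdvd : (k | s - 1 - 1)) by (exists (- t'); lia).
  assert (HE : forall y, up k (s - 1 - y - (s' + k * t')) = up k (s - 1) - 1 + up k (2 - y)).
  { intros y. rewrite ER. replace (s - 1 - y - -1) with (s - 1 + (1 - y)) by ring.
    rewrite up_add_congr_1 by assumption. do 2 f_equal. ring. }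
  apply (pseudo_symmetric_corner_right 1); try (assumption || lia).
  - rewrite HE, (up_1 k 1), (up_1 k (2 - 1)) by lia. ring.
  - intros y Hy Hne. rewrite HE.
    assert (y = 0 \/ y = 2) as [-> | ->] by lia.
    + rewrite up_0, (up_1 k (2 - 0)) by lia. ring.
    + rewrite (up_1 k 2), (up_unique k (2 - 2) 0) by lia. ring.
Qed.
End AperySet.

(** * From shapes to arithmetic conditions *)

(** Cramer's rule for the basis relations; with the analogous formula for [c] it expresses [a], [d],
    [c] through the basis. *)
Lemma reduced_basis_d (a d c k s s' P P' t t' : Z) :
  0 < a -> reduced_basis a d c k s s' P P' t t' -> d = t * P' - t' * P.
Proof.
  intros Ha [E E' Edet _ _ _ _]. apply Z.mul_reg_l with a; [lia|].
  rewrite <- Edet at 1.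
  transitivity (d * s * P' - d * s' * P); [ring|]. rewrite E, E'. ring.
Qed.

Lemma reduced_basis_c (a d c k s s' P P' t t' : Z) :
  0 < a -> reduced_basis a d c k s s' P P' t t' -> c = t * s' - t' * s.
Proof.
  intros Ha [E E' Edet _ _ _ _]. apply Z.mul_reg_l with a; [lia|].
  rewrite <- Edet at 1.
  transitivity (s * (c * P') - s' * (c * P)); [ring|].
  replace (c * P') with (d * s' - a * t') by lia. replace (c * P) with (d * s - a * t) by lia.
  ring.
Qed.

Lemma in_sg_incl (gs gs' : list Z) :
  (forall g, In g gs -> in_sg gs' g) -> forall z, in_sg gs z -> in_sg gs' z.
Proof. intros H. apply in_sg_ind; [apply in_sg_0|apply in_sg_add|exact H]. Qed.

Lemma in_sg_divide (gs : list Z) (x : Z) :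
  (forall g, In g gs -> (x | g)) -> forall z, in_sg gs z -> (x | z).
Proof.
  intros H. apply in_sg_ind; [apply Z.divide_0_r|intros; now apply Z.divide_add_r|exact H].
Qed.

Lemma gcd_1_of_divide (a d x y : Z) :
  Z.gcd a d = 1 -> (Z.gcd x y | a) -> (Z.gcd x y | d) -> Z.gcd x y = 1.
Proof.
  intros H Ha Hd. apply Z.divide_1_r_nonneg; [apply Z.gcd_nonneg|].
  rewrite <- H. now apply Z.gcd_greatest.
Qed.

(** Taking [k = 2] and repeating the last generator as [c] produces the hook shape with [P = 0]. *)
Lemma pseudo_symmetric_3 (d : Z) :
  0 < d -> Z.gcd 3 d = 1 -> pseudo_symmetric (in_sg (3 :: 3 + d :: 3 + 2 * d :: nil)).
Proof.
  intros Hd Hg.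
  apply pseudo_symmetric_ext with (ap_sg 3 d (3 + 2 * d) 2).
  - intros z. rewrite <- (in_ap_sg 3 d (3 + 2 * d) 2).
    split; apply in_sg_incl; intros g Hgen.
    + apply in_ap_gens in Hgen. apply in_sg_gen. cbn [In].
      destruct Hgen as [(i & Hi & ->)| ->]; [|tauto].
      assert (i = 0 \/ i = 1 \/ i = 2) as [->|[->| ->]] by lia; lia.
    + apply in_sg_gen, in_ap_gens. left. cbn [In] in Hgen.
      destruct Hgen as [<-|[<-|[<-|[]]]]; [exists 0|exists 1|exists 2]; lia.
  - apply (pseudo_symmetric_basis_b 3 d (3 + 2 * d) 2 3 2 0 1 d (-1)); try lia.
    constructor; lia.
Qed.

(** The L-shape is the row [y = 0, 1, 2], so the Apéry set of 3 is [0, 3 + d, 3 + 2 * d]. *)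
Lemma in_ap_gens_3 (d c : Z) (k : nat) (s s' t t' : Z) :
  0 < d -> 0 < c -> (2 <= k)%nat -> Z.gcd 3 d = 1 ->
  reduced_basis 3 d c (Z.of_nat k) s s' 0 1 t t' ->
  forall z, in_sg (ap_gens 3 d k c) z <-> in_sg (3 :: 3 + d :: 3 + 2 * d :: nil) z.
Proof.
  intros Hd Hc Hk Hg B z.
  assert (Es : s = 3) by (pose proof (rb_det _ _ _ _ _ _ _ _ _ _ B); lia).
  pose proof (rb_s'_s _ _ _ _ _ _ _ _ _ _ B) as Hs.
  split.
  - intros Hz. apply in_ap_sg in Hz. revert Hz.
    assert (HK : 0 < Z.of_nat k) by lia.
    destruct (lshape_rep 3 d c _ _ _ _ _ _ _ ltac:(lia) HK Hg B z) as (y & w & m & HL & ->).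
    rewrite (ap_sg_lshape 3 d c _ _ _ _ _ _ _ ltac:(lia) HK Hg B) by assumption. intros Hm.
    unfold lshape in HL. assert (w = 0) as -> by lia. unfold cost.
    assert (y = 0 \/ y = 1 \/ y = 2) as [->|[->| ->]] by lia.
    + exists m. split; [assumption|]. exists 0. split; [lia|]. exists 0. split; [lia|].
      cbn [in_sg]. rewrite up_0 by lia. lia.
    + exists m. split; [assumption|]. exists 1. split; [lia|]. exists 0. split; [lia|].
      cbn [in_sg]. rewrite up_1 by lia. lia.
    + exists m. split; [assumption|]. exists 0. split; [lia|]. exists 1. split; [lia|].
      cbn [in_sg]. rewrite up_1 by lia. lia.
  - apply in_sg_incl. intros g Hgen. apply in_sg_gen, in_ap_gens. left. cbn [In] in Hgen.
    destruct Hgen as [<-|[<-|[<-|[]]]]; [exists 0|exists 1|exists 2]; lia.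
Qed.

Theorem theorem10 (a d c : Z) (k : nat) :
  0 < a -> 0 < d -> 0 < c -> (2 <= k)%nat ->
  gcd_list (ap_gens a d k c) = 1 ->
  pseudo_symmetric (in_sg (ap_gens a d k c)) <->
  (Z.gcd a d = 1 /\
   ( (* (a) *)
     (forall z, in_sg (ap_gens a d k c) z <-> in_sg (3 :: 3 + d :: 3 + 2 * d :: nil) z)
   \/ (* (b) *)
     (a * (c - 1) = 2 * (c + d) /\ Z.Odd c)
   \/ (* (c.1) *)
     ((a mod 6 = 1 \/ a mod 6 = 5) /\ c * (a - 3) = 6 * d /\
      a <= 2 * Z.of_nat k * d + 3)
   \/ (* (c.2) *)
     (exists lam mu n : Z, 1 <= lam /\ 1 <= mu /\ 1 <= n /\
        a = (2 + lam * Z.of_nat k) * (n + 1) + 1 /\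
        c + (2 + lam * Z.of_nat k) * d = mu * a /\
        lam * (a + Z.of_nat k * d) = c * n - 3 * d)
   \/ (* (d) *)
     (exists lam mu v : Z, 2 <= lam /\ 1 <= mu /\ 0 <= v /\
        a = (v + 1) * (2 + (lam - 2) * Z.of_nat k) + (lam * Z.of_nat k + 1) /\
        c + (2 + (lam - 2) * Z.of_nat k) * d = mu * a /\
        lam * (a + Z.of_nat k * d) = c * (v + 1) - d)
   \/ (* (e) *)
     (exists q1 R0 s0 : Z, 2 <= q1 /\
        (Z.of_nat k | R0 - 2) /\ (Z.of_nat k | s0 - 2) /\
        a = (q1 - 1) * s0 + 1 /\
        a + Z.of_nat k * d = q1 * R0 + 2 * Z.of_nat k - 1 /\
        Z.of_nat k * c = (R0 + 2 * Z.of_nat k - 1) * (s0 - 1) + 2 * Z.of_nat k - 1)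
   \/ (* (f) *)
     (exists q1 R0 s0 : Z, 2 <= q1 /\
        (Z.of_nat k | R0 - 2) /\ (Z.of_nat k | s0 - 2) /\ s0 <> 2 /\
        a = (q1 - 1) * s0 + 3 /\
        a + Z.of_nat k * d = q1 * R0 + 1 /\
        Z.of_nat k * c = (R0 + 1) * (s0 - 3) + 3))).
Proof.
  intros Ha Hd Hc Hk Hgcd.
  assert (HS : pseudo_symmetric (in_sg (ap_gens a d k c)) <->
               pseudo_symmetric (ap_sg a d c (Z.of_nat k))).
  { split; apply pseudo_symmetric_ext; intros z; [|symmetry]; apply in_ap_sg. }
  rewrite HS.
  assert (Hgen3 := fun s s' t t' => in_ap_gens_3 d c k s s' t t' Hd Hc Hk).
  assert (HK : 2 <= Z.of_nat k) by lia. assert (HK0 : 0 < Z.of_nat k) by lia.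
  split.
  - intros HPS.
    assert (Hg : Z.gcd a d = 1).
    { apply (ap_sg_pseudo_symmetric_coprime a d c (Z.of_nat k)); try assumption.
      apply Z.divide_1_r_nonneg; [apply Z.gcd_nonneg|]. rewrite <- Hgcd.
      apply gcd_list_divide. intros g Hgen.
      pose proof (Z.gcd_divide_l (Z.gcd a d) c) as D1.
      pose proof (Z.gcd_divide_r (Z.gcd a d) c) as D2.
      apply in_ap_gens in Hgen as [(i & Hi & ->)| ->]; [|assumption].
      apply Z.divide_add_r; [|apply Z.divide_mul_r]; eapply Z.divide_trans; try exact D1.
      - apply Z.gcd_divide_l.
      - apply Z.gcd_divide_r. }
    split; [assumption|].
    destruct (reduced_basis_exists a d c (Z.of_nat k)) as (s & s' & P & P' & t & t' & B);
      try assumption.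
    pose proof (pseudo_symmetric_basis a d c _ _ _ _ _ _ _ Ha Hd Hc HK0 Hg B HK HPS) as Hcase.
    clear HPS HS Hgcd.
    pose proof (reduced_basis_d _ _ _ _ _ _ _ _ _ _ Ha B) as Edm.
    pose proof (reduced_basis_c _ _ _ _ _ _ _ _ _ _ Ha B) as Ecm.
    pose proof B as [E E' Edet Hs HP HR HR'].
    set (K := Z.of_nat k) in *.
    destruct Hcase as [Hcase|[Hcase|[Hcase|[Hcase|[Hcase|Hcase]]]]].
    + left. destruct Hcase as (-> & -> & ->). assert (a = 3) as -> by lia.
      exact (Hgen3 _ _ _ _ Hg B).
    + right; left. clear Hgen3 B. clearbody K. destruct Hcase as (-> & -> & -> & ->).
      assert (a = P + 3) as -> by lia. assert (c = 2 * t + 3) as -> by lia.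
      split; [|exists (t + 1)]; lia.
    + clear Hgen3 B. clearbody K. destruct Hcase as (Hs3 & -> & -> & ER).
      assert (HP0 : 1 <= P).
      { destruct (Z.eq_dec P 0) as [->|]; nia. }
      destruct (Z.eq_dec t 0) as [->|Ht].
      * right; right; left. assert (s = 3) as -> by lia.
        assert (a = 2 * P + 3) as -> by lia.
        assert (c = - 3 * t') as -> by lia. assert (d = - t' * P) as -> by lia.
        split; [|split; nia].
        (* If 3 divided [P], it would divide both [a = 2 * P + 3] and [d]; hence the odd number [a]
           is 1 or 5 modulo 6. *)
        destruct (Z.eq_dec (P mod 3) 0) as [HP3|HP3].
        { exfalso. apply Z.mod_divide in HP3; [|lia]. destruct HP3 as [p ->].
          assert (D : (3 | 1)).
          { rewrite <- Hg. apply Z.gcd_greatest; [exists (2 * p + 1)|exists (- t' * p)]; ring. }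
          destruct D. lia. }
        pose proof (Z.div_mod P 3). pose proof (Z.mod_pos_bound P 3).
        pose proof (Z.div_mod (2 * P + 3) 6). pose proof (Z.mod_pos_bound (2 * P + 3) 6). lia.
      * right; right; right; left. exists (- t), (t - t'), P.
        assert (t < 0) by nia.
        assert (s = 3 - K * t) as -> by lia.
        (* Difference of the two basis relations, since [s - s' = 2 - t * K] and [P' - P = 1]. *)
        assert (Emu : c + (2 + - t * K) * d = (t - t') * a) by lia.
        assert (0 < (2 + - t * K) * d) by (apply Z.mul_pos_pos; nia).
        assert (0 < t - t') by (apply Z.mul_pos_cancel_r with a; lia).
        repeat split; lia.
    + right; right; right; right; left. clear Hgen3 B. clearbody K.
      destruct Hcase as (Hs3 & -> & -> & ER).
      assert (t <= -2) by (apply (Z.mul_le_mono_pos_l _ _ K); lia).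
      assert (HP0 : 1 <= P).
      { destruct (Z.eq_dec P 0) as [->|]; nia. }
      exists (- t), (t - t'), (P - 1).
      assert (s = 1 - K * t) as -> by lia.
      assert (Emu : c + (2 + (- t - 2) * K) * d = (t - t') * a) by lia.
      assert (0 < (2 + (- t - 2) * K) * d) by (apply Z.mul_pos_pos; nia).
      assert (0 < t - t') by (apply Z.mul_pos_cancel_r with a; lia).
      repeat split; lia.
    + right; right; right; right; right; left. clear Hgen3 B. clearbody K.
      destruct Hcase as (Hs2 & -> & -> & ER).
      exists P', (s + K * t), s.
      split; [lia|]. split; [exists (t - t' - 2); lia|]. split; [exists (- t' - 2); lia|].
      split; [lia|]. assert (Es : s = 2 - 2 * K - K * t') by lia.
      split; [rewrite Edm; lia|rewrite Ecm, Es; ring].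
    + right; right; right; right; right; right. clear Hgen3 B. clearbody K.
      destruct Hcase as (Hs2 & -> & -> & ER).
      exists P', (s + K * t), s.
      split; [lia|]. split; [exists (t - t'); lia|]. split; [exists (- t'); lia|].
      split; [lia|]. split; [lia|]. assert (Es : s = 2 - K * t') by lia.
      split; [rewrite Edm; lia|rewrite Ecm, Es; ring].
  - intros (Hg & Hcase). clear Hgcd.
    pose proof (pseudo_symmetric_basis_b a d c (Z.of_nat k)) as Ib.
    pose proof (pseudo_symmetric_basis_c a d c (Z.of_nat k)) as Ic.
    pose proof (pseudo_symmetric_basis_d a d c (Z.of_nat k)) as Id.
    pose proof (pseudo_symmetric_basis_e a d c (Z.of_nat k)) as Ie.
    pose proof (pseudo_symmetric_basis_f a d c (Z.of_nat k)) as If.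
    destruct Hcase as [Hcase|Hcase].
    { apply HS.
      apply pseudo_symmetric_ext with (in_sg (3 :: 3 + d :: 3 + 2 * d :: nil));
        [intros z; symmetry; apply Hcase|].
      apply pseudo_symmetric_3; [assumption|].
      apply (gcd_1_of_divide a d); [assumption| |apply Z.gcd_divide_r].
      apply in_sg_divide with (3 :: 3 + d :: 3 + 2 * d :: nil).
      - pose proof (Z.gcd_divide_l 3 d). pose proof (Z.gcd_divide_r 3 d).
        intros g [<-|[<-|[<-|[]]]]; auto using Z.divide_add_r, Z.divide_mul_r.
      - apply Hcase, in_sg_gen, in_ap_gens. left. exists 0. lia. }
    clear HS Hgen3. set (K := Z.of_nat k) in *. clearbody K.
    destruct Hcase as [(E & m & Em)|[Hcase|[Hcase|[Hcase|[Hcase|Hcase]]]]].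
    + assert (Em' : a * m = 2 * m + 1 + d) by lia.
      assert (1 <= m) by lia. assert (3 <= a) by nia.
      (* The determinant gives [P = a - 3], and [c = 2 * t + 3] gives [t = m - 1]. *)
      apply (Ib 3 2 (a - 3) (a - 2) (m - 1) (-1)); try assumption; try lia.
      subst c. constructor; try lia. nia.
    + destruct Hcase as (Ha6 & E & Hle).
      pose proof (Z.div_mod a 6 ltac:(lia)) as Hdm. set (q := a / 6) in *. clearbody q.
      assert (exists n p, a = 2 * n + 3 /\ c = p * 3) as (n & p & -> & ->).
      { destruct Ha6 as [Ha6|Ha6]; rewrite Ha6 in Hdm.
        - exists (3 * q - 1), (c * q - d). subst a. lia.
        - exists (3 * q + 1), (d - c * q). subst a. lia. }
      assert (Ed : d = p * n) by lia.
      assert (1 <= n) by nia.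
      apply (Ic 3 1 n (n + 1) 0 (- p)); try assumption; try lia.
      rewrite Ed in *. constructor; try lia.
    + destruct Hcase as (lam & mu & n & Hlam & Hmu & Hn & E1 & E2 & E3).
      assert (0 < lam * K) by nia. assert (0 < mu * K) by nia.
      apply (Ic (3 + lam * K) 1 n (n + 1) (- lam) (- lam - mu)); try assumption; try lia.
      constructor; lia.
    + destruct Hcase as (lam & mu & v & Hlam & Hmu & Hv & E1 & E2 & E3).
      assert (2 * K <= lam * K) by nia. assert (0 < mu * K) by nia.
      apply (Id (1 + lam * K) (2 * K - 1) (v + 1) (v + 2) (- lam) (- lam - mu));
        try (assumption || lia).
      constructor; lia.
    + destruct Hcase as (q & R & s & Hq & [rho ER] & [sig Es] & E1 & E2 & E3).
      assert (EKd : q * R + 2 * K - 1 - a = K * d) by lia.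
      assert (0 <= s) by (apply (Z.mul_nonneg_cancel_l (q - 1)); lia).
      assert (HKd : K <= K * d) by (clear - HK0 Hd; nia).
      assert (HKc : 0 < K * c) by (apply Z.mul_pos_pos; lia).
      (* For [R <= 0], the bound [q * R >= a + 1 - K] leaves only [K = 2], [R = 0], [a = 1],
         [s = 0], which makes [c] vanish. *)
      assert (HR : 0 < R).
      { destruct (Z_lt_ge_dec 0 R) as [|HR]; [assumption|exfalso].
        assert (q * R <= 2 * R) by (clear - Hq HR; nia).
        assert (Hrho : rho < 0) by (clear - ER HR HK0; nia).
        destruct (Z.eq_dec rho (-1)) as [->|Hn];
          [|assert (rho * K <= - 2 * K) by (clear - HK0 Hrho Hn; nia); lia].
        assert (K = 2) by lia. assert (R = 0) by lia. assert (Ea : a = 1) by lia.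
        assert (s = 0) by (clear - E1 Ea Hq; nia). subst s R. lia. }
      assert (Hs : 2 <= s).
      { destruct (Z.eq_dec s 0) as [->|]; [lia|].
        destruct (Z.eq_dec s 1) as [->|]; [|lia].
        assert (1 - 2 = 0) by (apply (divide_small K); [exists sig|]; lia). lia. }
      (* The last two arguments solve [s + K * t = R] and [s - 1 + K * t' = 1 - 2 * K]. *)
      apply (Ie s (s - 1) 1 q (rho - sig) (- sig - 2)); try assumption; try lia.
      constructor; try lia.
      * apply Z.mul_reg_l with K; [lia|].
        transitivity ((q * R + 2 * K - 1 - a) * s); [rewrite EKd; ring|].
        transitivity (K * c + a * (R - s)); [rewrite E3, E1; ring|].
        replace (R - s) with (K * (rho - sig)) by lia. ring.
      * apply Z.mul_reg_l with K; [lia|].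
        transitivity ((q * R + 2 * K - 1 - a) * (s - 1)); [rewrite EKd; ring|].
        transitivity (K * c * q + a * (- (s - 2) - 2 * K)); [rewrite E3, E1; ring|].
        rewrite Es. ring.
    + destruct Hcase as (q & R & s & Hq & [rho ER] & [sig Es] & Hs2 & E1 & E2 & E3).
      assert (EKd : q * R + 1 - a = K * d) by lia.
      assert (HKd : K <= K * d) by (clear - HK0 Hd; nia).
      assert (HKc : 0 < K * c) by (apply Z.mul_pos_pos; lia).
      assert (HR : 0 < R) by (apply (Z.mul_pos_cancel_l q); lia).
      (* For [s <= 1] the formula for [K * c] would make it negative. *)
      assert (Hs : 3 <= s).
      { destruct (Z_le_gt_dec 3 s); [assumption|exfalso].
        assert (2 * 2 <= (R + 1) * (3 - s)) by (apply Z.mul_le_mono_nonneg; lia). lia. }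
      apply (If s (s - 3) 1 q (rho - sig) (- sig)); try assumption; try lia.
      constructor; try lia.
      * apply Z.mul_reg_l with K; [lia|].
        transitivity ((q * R + 1 - a) * s); [rewrite EKd; ring|].
        transitivity (K * c + a * (R - s)); [rewrite E3, E1; ring|].
        replace (R - s) with (K * (rho - sig)) by lia. ring.
      * apply Z.mul_reg_l with K; [lia|].
        transitivity ((q * R + 1 - a) * (s - 3)); [rewrite EKd; ring|].
        transitivity (K * c * q + a * - (s - 2)); [rewrite E3, E1; ring|].
        rewrite Es. ring.
Qed.
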